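(* Let $\Omega\subset\mathbb{R}^d$ be open and let $\Phi$ be a Musielak-Orlicz function on $\Omega$. If $|\operatorname{Sing}\Phi|>0$, then $C_C^\infty(\Omega)\cap E^\Phi(\Omega)$ is not dense in $(E^\Phi(\Omega),\|\cdot\|_\Phi)$.
   Context: $|\cdot|$ denotes Lebesgue measure on $\mathbb{R}^d$, and $L^0(\Omega)$ is the set of all Lebesgue measurable complex-valued functions on $\Omega$. A Musielak-Orlicz function on $\Omega$ is a function $\Phi:\Omega\times[0,\infty)\to[0,\infty)$ such that: (a) for every $x\in\Omega$, $t\mapsto\Phi(x,t)$ is convex; (b) for every $x\in\Omega$, $\Phi(x,t)=0$ if and only if $t=0$; (c) for every $t\in[0,\infty)$, $x\mapsto\Phi(x,t)$ is Lebesgue measurable on $\Omega$. Put $I_\Phi(f)=\int_\Omega\Phi(x,|f(x)|)\,dx$ for $f\in L^0(\Omega)$. The Musielak-Orlicz space is $L^\Phi(\Omega)=\{f\in L^0(\Omega):\exists\lambda>0,\ I_\Phi(\lambda f)<\infty\}$, normed by $\|f\|_\Phi=\inf\{\lambda>0: I_\Phi(f/\lambda)\le 1\}$, and $E^\Phi(\Omega)=\{f\in L^0(\Omega):\forall\lambda>0,\ I_\Phi(\lambda f)<\infty\}$ is a closed subspace (functions equal a.e. are identified). $C_C^\infty(\Omega)$ is the set of infinitely differentiable complex-valued functions on $\Omega$ with compact support contained in $\Omega$. The set of singular points of $\Phi$ is $\operatorname{Sing}\Phi=\{x\in\mathbb{R}^d:\ \forall r>0\ \exists t_r>0,\ \int_{B(x,r)\cap\Omega}\Phi(y,t_r)\,dy=\infty\}$,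 where $B(x,r)$ is the open Euclidean ball with center $x$ and radius $r$.
   Formalization: The hypothesis |Sing Φ|>0 is replaced by |Sing Φ ∩ Ω|>0; as stated it fails for Ω = R∖C with C a fat Cantor set and Φ(x,t)=t/dist(x,C), where every point of C is singular yet C_C^∞(Ω) is dense in E^Φ(Ω). *)

(* Defs.v *)
From HB Require Import structures.
From mathcomp Require Import all_boot all_order all_algebra.
From mathcomp Require Import all_classical all_reals all_analysis.
From mathcomp Require Import complex.

Set Implicit Arguments.
Unset Strict Implicit.
Unset Printing Implicit Defensive.
Import Order.TTheory GRing.Theory Num.Theory.
Import numFieldNormedType.Exports.

Local Open Scope classical_set_scope.
Local Open Scope ring_scope.

Notation modulus := ComplexField.Normc.normc.

Section lebesgue_outer_measure.
Context {R : realType} {d : nat}.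

(* [None] stands for the empty cell; it is only needed when d = 0, where every
   product of intervals is the whole one-point space. *)
Definition cell (c : option ('rV[R]_d * 'rV[R]_d)) : set 'rV[R]_d :=
  if c is Some (a, b) then [set x | forall i, a 0 i < x 0 i <= b 0 i]
  else set0.

Definition cell_volume (c : option ('rV[R]_d * 'rV[R]_d)) : R :=
  if c is Some (a, b) then \prod_(i < d) Num.max (b 0 i - a 0 i) 0 else 0.

Local Open Scope ereal_scope.

Definition lebesgue_outer (A : set 'rV[R]_d) : \bar R :=
  ereal_inf [set \sum_(k <oo) (cell_volume (c k))%:E |
    c in [set c : nat -> option ('rV[R]_d * 'rV[R]_d) |
          A `<=` \bigcup_k cell (c k)]].

Lemma cell_volume_ge0 c : (0 <= cell_volume c)%R.
Proof.
case: c => [[a b]|//=]; apply: prodr_ge0 => i _.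
by rewrite le_max lexx orbT.
Qed.

Let cell_volumee_ge0 c : 0 <= (cell_volume c)%:E.
Proof. by rewrite lee_fin cell_volume_ge0. Qed.

Lemma lebesgue_outer_ge0 A : 0 <= lebesgue_outer A.
Proof.
by apply: le_ereal_inf_tmp => _ [c _ <-]; apply: nneseries_ge0 => k _ _.
Qed.

Lemma le_lebesgue_outer : {homo lebesgue_outer : A B / A `<=` B >-> A <= B}.
Proof.
move=> A B AB; apply/ereal_inf_le_tmp => _ [c Bc <-].
by exists c => //; apply: subset_trans AB Bc.
Qed.

Lemma lebesgue_outer0 : lebesgue_outer set0 = 0.
Proof.
apply/eqP; rewrite eq_le lebesgue_outer_ge0 andbT.
apply: ereal_inf_lbound; exists (fun=> None) => //.
by apply: eseries0 => k _ _.
Qed.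

Lemma lebesgue_outer_sigma_subadditive : sigma_subadditive lebesgue_outer.
Proof.
move=> A; have [[i ioo]|] := pselect (exists i, lebesgue_outer (A i) = +oo).
  rewrite (eseries_pinfty _ _ ioo) ?leey// => n _.
  by rewrite -ltNye (lt_le_trans _ (lebesgue_outer_ge0 _)).
rewrite -forallNE => Aoo.
apply/lee_addgt0Pr => e e0.
rewrite (le_trans _ (epsilon_trick _ _ (ltW e0)))//; last first.
  by move=> n; exact: lebesgue_outer_ge0.
pose P n (c : nat -> option ('rV[R]_d * 'rV[R]_d)) :=
  A n `<=` \bigcup_k cell (c k) /\
  \sum_(k <oo) (cell_volume (c k))%:E <=
    lebesgue_outer (A n) + (e / (2 ^ n.+1)%:R)%:E.
have [G PG] : {G & forall n, P n (G n)}.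
  apply: (@choice _ _ P) => n; rewrite /P.
  have en1 : (0 < e / (2 ^ n.+1)%:R)%R.
    by rewrite divr_gt0// ltr0n expn_gt0.
  have fA : lebesgue_outer (A n) \is a fin_num.
    by rewrite ge0_fin_numE ?lebesgue_outer_ge0// ltey; apply/eqP/Aoo.
  have [_ [c Ac <-] /ltW cle] := lb_ereal_inf_adherent en1 fA.
  by exists c.
pose vol (p : nat * nat) := (cell_volume (G p.1 p.2))%:E.
have vol_ge0 p : 0 <= vol p by exact: cell_volumee_ge0.
apply: (@le_trans _ _ (\esum_(p in setT) vol p)).
  apply: ereal_inf_lbound => /=.
  have /card_esym/ppcard_eqP[f] := card_nat2.
  exists (fun k => G (f k).1 (f k).2).
    move=> t [i _ Ait]; have [j _ Gt] := (PG i).1 _ Ait.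
    by exists (f^-1%FUN (i, j)) => //=; rewrite invK ?inE.
  rewrite -(esum_pred_image vol _ xpredT) ?[fun=> _]set_true//.
  by rewrite image_eq.
rewrite (_ : esum _ _ = \sum_(i <oo) \sum_(j <oo) vol (i, j)); last first.
  pose J : nat -> set (nat * nat) := fun i => [set (i, j) | j in setT].
  rewrite (_ : setT = \bigcup_k J k); last first.
    by rewrite predeqE => -[a b]; split => // _; exists a => //; exists b.
  rewrite esum_bigcupT //=; last first.
    apply/trivIsetP => i j _ _ ij.
    rewrite predeqE => -[n m] /=; split => //= -[] [_] _ [<-{n} _].
    by move=> [m' _] [] /esym/eqP; rewrite (negbTE ij).
  rewrite -(image_id [set: nat]) -fun_true esum_pred_image//; last first.
    by move=> n _; exact: esum_ge0.
  apply: eq_eseriesr => /= j _.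
  rewrite -(esum_pred_image vol (pair j) predT)//=; last first.
    by move=> ? ? _ _; exact: (@can_inj _ _ _ snd).
  by congr esum; rewrite predeqE => -[a b]; split; move=> [i _ <-]; exists i.
apply: lee_lim.
- by apply: is_cvg_nneseries => n _ _; apply: nneseries_ge0.
- apply: is_cvg_nneseries => n _ _; apply: adde_ge0.
    exact: lebesgue_outer_ge0.
  by rewrite lee_fin divr_ge0// ltW.
- by near=> n; apply: lee_sum => i _; exact: (PG i).2.
Unshelve. all: by end_near. Qed.

HB.instance Definition _ := isOuterMeasure.Build R 'rV[R]_d lebesgue_outer
  lebesgue_outer0 lebesgue_outer_ge0 le_lebesgue_outer
  lebesgue_outer_sigma_subadditive.

End lebesgue_outer_measure.

(* 'rV[R]_d with the sigma-algebra of Lebesgue (not only Borel) measurable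
   sets, i.e. of the Caratheodory measurable sets of [lebesgue_outer]. *)
Notation lebesgue_space R d := (caratheodory_type (@lebesgue_outer R d)).

Definition lebesgue_rV (R : realType) (d : nat) :
    set (lebesgue_space R d) -> \bar R := @lebesgue_outer R d.

HB.instance Definition _ (R : realType) (d : nat) :=
  Measure.copy (@lebesgue_rV R d)
    ((@lebesgue_outer R d : {outer_measure set _ -> \bar R}) :
       set (lebesgue_space R d) -> \bar R).

(* The norm of 'rV[R]_d in the library is the sup norm, which induces the same
   topology but different balls. *)
Definition euclidean_ball {R : realType} {d : nat} (x : 'rV[R]_d) (r : R) :
    set 'rV[R]_d :=
  [set y | Num.sqrt (\sum_(i < d) (y 0 i - x 0 i) ^+ 2) < r].

(* Functions on Omega are total functions whose values outside Omega play no
   role; likewise [Phi x t] is only relevant for x in Omega and t >= 0. *)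
Section musielak_orlicz.
Context {R : realType} {d : nat}.
Implicit Types (Omega : set 'rV[R]_d) (Phi : 'rV[R]_d -> R -> R)
  (f g : 'rV[R]_d -> R[i]).

Record musielak_orlicz_function Omega Phi : Prop := {
  mo_ge0 : forall x t, Omega x -> 0 <= t -> 0 <= Phi x t ;
  mo_convex : forall x, Omega x ->
    convex_function (`[0, +oo[%classic : set R) (Phi x) ;
  mo_eq0 : forall x t, Omega x -> 0 <= t -> (Phi x t = 0 <-> t = 0) ;
  mo_measurable : forall t, 0 <= t ->
    measurable_fun (Omega : set (lebesgue_space R d)) (Phi ^~ t) }.

Definition L0 Omega : set ('rV[R]_d -> R[i]) :=
  [set f |
    measurable_fun (Omega : set (lebesgue_space R d)) (fun x => complex.Re (f x)) /\
    measurable_fun (Omega : set (lebesgue_space R d)) (fun x => complex.Im (f x))].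

Definition modular Omega Phi f : \bar R :=
  (\int[@lebesgue_rV R d]_(x in Omega) (Phi x (modulus (f x)))%:E)%E.

Definition LPhi Omega Phi : set ('rV[R]_d -> R[i]) :=
  [set f | L0 Omega f /\ exists2 l : R, 0 < l &
    (modular Omega Phi (fun x => (l%:C)%C * f x)%R < +oo)%E].

Definition EPhi Omega Phi : set ('rV[R]_d -> R[i]) :=
  [set f | L0 Omega f /\ forall l : R, 0 < l ->
    (modular Omega Phi (fun x => (l%:C)%C * f x)%R < +oo)%E].

(* A real number on [LPhi Omega Phi]. *)
Definition luxemburg_norm Omega Phi f : \bar R :=
  ereal_inf [set l%:E | l in [set l : R | 0 < l /\
    (modular Omega Phi (fun x => f x / (l%:C)%C)%R <= 1)%E]].

(* These points range over the whole space, so boundary points of Omega may be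
   singular. Only those in Omega obstruct the approximation by Cc_infty: if C is
   a nowhere dense compact subset of the line of positive measure, Omega = ~` C
   and Phi x t = t / dist(x, C), then every point of C is singular, although
   compactly supported smooth functions are dense in EPhi. *)
Definition singular_points Omega Phi : set 'rV[R]_d :=
  [set x | forall r : R, 0 < r -> exists2 t : R, 0 < t &
    (\int[@lebesgue_rV R d]_(y in euclidean_ball x r `&` Omega)
       (Phi y t)%:E = +oo)%E].

Definition iterated_partial (s : seq 'I_d) (u : 'rV[R]_d -> R) :
    'rV[R]_d -> R :=
  foldr (fun i v => fun x => 'D_(delta_mx 0 i) v x) u s.

(* Frechet differentiability of the iterated partial derivatives of every
   order makes all of them continuous, hence this is C^infinity. *)
Definition smooth_on Omega (u : 'rV[R]_d -> R) : Prop :=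
  forall (s : seq 'I_d) x, Omega x -> differentiable (iterated_partial s u) x.

Definition support_on Omega f : set 'rV[R]_d :=
  closure [set x | Omega x /\ f x != 0].

Definition Cc_infty Omega : set ('rV[R]_d -> R[i]) :=
  [set f | [/\ smooth_on Omega (fun x => complex.Re (f x)),
               smooth_on Omega (fun x => complex.Im (f x)),
               compact (support_on Omega f) &
               support_on Omega f `<=` Omega]].

(* Density of A in E for the topology of the norm N. Since [luxemburg_norm]
   does not see null sets, this may be checked on representatives. *)
Definition norm_dense (N : ('rV[R]_d -> R[i]) -> \bar R)
    (A E : set ('rV[R]_d -> R[i])) : Prop :=
  A `<=` E /\ forall f, E f -> forall e : R, 0 < e ->
    exists2 g, A g & (N (fun x => f x - g x)%R < e%:E)%E.

End musielak_orlicz.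

(* Main.v *)
Require Import Defs.
From mathcomp Require Import all_boot all_order all_algebra.
From mathcomp Require Import all_classical all_reals all_analysis.
From mathcomp Require Import complex.
From mathcomp Require Import lra.
Import numFieldNormedType.Exports.
Local Open Scope classical_set_scope.
Local Open Scope ring_scope.
Import Order.TTheory GRing.Theory Num.Theory.

Set Implicit Arguments.
Unset Strict Implicit.
Unset Printing Implicit Defensive.

(** A function g in both [Cc_infty] and [EPhi] vanishes at every singular point of
    Omega: otherwise |g| is bounded below near that point and some modular of a
    multiple of g is infinite. The set of singular points in Omega is measurable
    of positive measure, hence contains a set A of finite positive measure on
    which Phi(., 1) is bounded away from 0 and every Phi(., n) is bounded. Then
    the indicator of A belongs to [EPhi], while |1_A - g| = 1 on A keeps the
    Luxemburg norm of 1_A - g away from 0.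

    The singular points form a closed set, so what must be known about
    [lebesgue_outer] is that open sets are Caratheodory measurable. A half-space
    is, since it cuts each cell of a cover into two cells whose volumes add up. *)

Section lebesgue_measurable_sets.
Context {R : realType} {d : nat}.
Implicit Types (c : option ('rV[R]_d * 'rV[R]_d)) (i : 'I_d) (s : R).

Definition halfspace i s : set 'rV[R]_d := [set x | x 0 i <= s].

Definition cell_below i s c : option ('rV[R]_d * 'rV[R]_d) :=
  if c is Some (a, b) then
    Some (a, \row_j if j == i then Num.min (b 0 j) s else b 0 j) else None.

Definition cell_above i s c : option ('rV[R]_d * 'rV[R]_d) :=
  if c is Some (a, b) then
    Some (\row_j if j == i then Num.max (a 0 j) s else a 0 j, b) else None.

Lemma cell_setI_halfspace i s c :
  cell c `&` halfspace i s `<=` cell (cell_below i s c).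
Proof.
case: c => [[a b]|] x [] //= xab xs j; rewrite mxE.
by case: eqP => [->|_//]; rewrite le_min (andP (xab i)).1 (andP (xab i)).2.
Qed.

Lemma cell_setD_halfspace i s c :
  cell c `&` ~` halfspace i s `<=` cell (cell_above i s c).
Proof.
case: c => [[a b]|] x [] //= xab /negP; rewrite -ltNge => xs j; rewrite mxE.
by case: eqP => [->|_//]; rewrite gt_max (andP (xab i)).1 xs (andP (xab i)).2.
Qed.

Lemma cell_volume_split i s c :
  cell_volume (cell_below i s c) + cell_volume (cell_above i s c) =
  cell_volume c.
Proof.
case: c => [[a b]|] /=; last by rewrite addr0.
rewrite (bigD1 i)//= [X in _ + X](bigD1 i)//= [RHS](bigD1 i)//= !mxE eqxx.
under eq_bigr => j /negbTE ji do rewrite !mxE ji.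
under [X in _ + _ * X]eq_bigr => j /negbTE ji do rewrite !mxE ji.
rewrite -mulrDl; congr (_ * _).
rewrite /Num.max /Num.min; case: (ltP (b 0 i) s); case: (ltP (a 0 i) s) => ? ?;
  by do ![case: ltP => ?]; lra.
Qed.

Lemma halfspace_measurable i s :
  measurable (halfspace i s : set (lebesgue_space R d)).
Proof.
apply: le_caratheodory_measurable => X.
apply: le_ereal_inf_tmp => _ [c Xc <-].
have vol0 c' : (0 <= (cell_volume c')%:E)%E by rewrite lee_fin cell_volume_ge0.
under eq_eseriesr => k _ do rewrite -(cell_volume_split i s (c k)) EFinD.
rewrite nneseriesD//; apply: leeD; apply: ereal_inf_lbound.
  exists (cell_below i s \o c) => // x [/Xc[k _ ckx] xs].
  by exists k => //; exact: cell_setI_halfspace.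
exists (cell_above i s \o c) => // x [/Xc[k _ ckx] xs].
by exists k => //; exact: cell_setD_halfspace.
Qed.

Lemma cell_measurable c : measurable (cell c : set (lebesgue_space R d)).
Proof.
case: c => [[a b]|] /=; last exact: measurable0.
rewrite [X in measurable X](_ : _ =
    \bigcap_i (~` halfspace i (a 0 i) `&` halfspace i (b 0 i))).
  apply: fin_bigcap_measurable; first exact: finite_finset.
  move=> i _; apply: measurableI; last exact: halfspace_measurable.
  by apply: measurableC; exact: halfspace_measurable.
apply/seteqP; split=> x xab i.
  move=> _; have /andP[ax bx] := xab i.
  by split=> //; apply/negP; rewrite -ltNge.
by have [/negP] := xab i I; rewrite -ltNge => -> ->.
Qed.

Lemma cell_lt_pinfty c : (@lebesgue_rV R d (cell c) < +oo)%E.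
Proof.
apply: (@le_lt_trans _ _ (cell_volume c)%:E); last exact: ltry.
apply: ereal_inf_lbound; exists (fun k => if k == 0%N then c else None).
  by move=> x cx; exists 0%N.
rewrite (@nneseries_split _ _ 0 1) => [|k _]; last first.
  by rewrite lee_fin cell_volume_ge0.
by rewrite big_nat1 eseries0 ?adde0// => -[].
Qed.

Lemma open_lebesgue_measurable (U : set 'rV[R]_d) :
  open U -> measurable (U : set (lebesgue_space R d)).
Proof.
move=> oU.
pose q (p : 'rV[rat]_d * 'rV[rat]_d) : option ('rV[R]_d * 'rV[R]_d) :=
  Some (map_mx ratr p.1, map_mx ratr p.2).
rewrite (_ : U = \bigcup_p (if `[< cell (q p) `<=` U >] then cell (q p)
                            else set0)); last first.
  apply/seteqP; split=> [x Ux|x [p _]]; last by case: ifPn => // /asboolP; apply.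
  have /nbhs_ballP[e /= e0 xeU] : nbhs x U by exact: open_nbhs_nbhs.
  have [a xa] : {a : 'I_d -> rat & forall i, ratr (a i) \in `]x 0 i - e, x 0 i[}.
    apply: (@choice _ _ (fun i r => ratr r \in `]x 0 i - e, x 0 i[)) => i.
    by apply: rat_in_itvoo; rewrite ltrBlDr ltrDl.
  have [b xb] : {b : 'I_d -> rat & forall i, ratr (b i) \in `]x 0 i, x 0 i + e[}.
    apply: (@choice _ _ (fun i r => ratr r \in `]x 0 i, x 0 i + e[)) => i.
    by apply: rat_in_itvoo; rewrite ltrDl.
  exists (\row_i a i, \row_i b i) => //.
  rewrite ifT.
    move=> i; rewrite !mxE; move: (xa i) (xb i); rewrite !in_itv/=.
    by move=> /andP[_ ->] /andP[/ltW].
  apply/asboolP => y yab; apply: xeU; split=> // j i; rewrite (ord1 j).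
  move: (yab i) (xa i) (xb i); rewrite !mxE !in_itv/= /ball/=.
  by move=> /andP[? ?] /andP[? ?] /andP[? ?]; rewrite ltr_norml; lra.
apply: countable_bigcupT_measurable => // p.
by case: ifPn => _; [exact: cell_measurable|exact: measurable0].
Qed.

End lebesgue_measurable_sets.

Section measure_lemmas.
Context {disp : measure_display} {T : measurableType disp} {R : realType}.
Variable mu : {measure set T -> \bar R}.

(* The integral of a nonnegative function is the supremum of the integrals of
   the simple functions below it, hence is monotone even without measurability:
   that of [fun x => Phi x (modulus (g x))] never has to be established. *)
Lemma ge0_le_integral_supp (A B : set T) (f g : T -> \bar R) :
  (forall x, A x -> 0 <= f x)%E -> (forall x, B x -> 0 <= g x)%E ->
  (forall x, A x -> B x -> f x <= g x)%E ->
  (forall x, A x -> ~ B x -> f x = 0%E) ->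
  (\int[mu]_(x in A) f x <= \int[mu]_(x in B) g x)%E.
Proof.
move=> f0 g0 fg fN; rewrite !ge0_integralE//; apply: ereal_sup_le.
move=> _ [h /= hf <-]; exists h => //= x; apply: le_trans (hf x) _.
rewrite /patch; case: ifPn => [/set_mem Ax|_]; last first.
  by case: ifPn => // /set_mem; exact: g0.
case: ifPn => [/set_mem|/negP xB]; first exact: fg.
by rewrite fN// => /mem_set.
Qed.

Lemma measure_bigcup_gt0 (A : set T) (B : (set T)^nat) :
  measurable A -> (forall n, measurable (B n)) ->
  A `<=` \bigcup_n B n -> (0 < mu A)%E -> exists n, (0 < mu (B n))%E.
Proof.
move=> mA mB AB muA; apply: contrapT => /forallNP B0.
have := measure_sigma_subadditive mu mB mA AB.
rewrite eseries0 => [|n _ _]; first by rewrite leNgt muA.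
by apply/eqP; rewrite eq_le measure_ge0 andbT leNgt; apply/negP/B0.
Qed.

Lemma bounded_on_large_subset (B : set T) (F : nat -> T -> R) :
  measurable B -> (0 < mu B < +oo)%E -> (forall n, measurable_fun B (F n)) ->
  exists A, [/\ measurable A, A `<=` B, (0 < mu A)%E &
    forall n, exists M : R, forall x, A x -> F n x <= M].
Proof.
move=> mB /andP[B0 Boo] mF.
have fB : mu B \is a fin_num by rewrite ge0_fin_numE.
pose e := fine (mu B) / 2.
have e0 : 0 < e by rewrite divr_gt0// fine_gt0// B0.
pose E n m := B `&` [set x | m%:R < F n x].
have mE n m : measurable (E n m).
  have -> : E n m = B `&` (F n) @^-1` `]m%:R, +oo[.
    by apply/seteqP; split=> x /= [Bx]; rewrite in_itv/= andbT.
  by apply: mF.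
have E_small n : {m | (mu (E n m) < (e / (2 ^ n.+1)%:R)%:E)%E}.
  apply: cid; have : (mu \o E n) m @[m --> \oo] --> mu (\bigcap_m E n m).
    apply: nonincreasing_cvg_mu => //.
    - by apply: le_lt_trans Boo; apply: le_measure; rewrite ?inE// => x [].
    - exact: bigcapT_measurable.
    - move=> m k mk; apply/subsetPset => x [Bx /= kx]; split=> //=.
      by apply: le_lt_trans kx; rewrite ler_nat.
  have -> : \bigcap_m E n m = set0.
    apply/seteqP; split=> // x /(_ (Num.truncn (F n x)).+1 I)[_ /=].
    by rewrite ltNge ltW// truncnS_gt.
  rewrite measure0 => /fine_cvgP[finE /cvgrPdist_lt cvgE].
  have en0 : 0 < e / (2 ^ n.+1)%:R by rewrite divr_gt0// ltr0n expn_gt0.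
  near \oo => m; exists m.
  have finEm : mu (E n m) \is a fin_num by near: m.
  rewrite -(fineK finEm) lte_fin.
  apply: le_lt_trans (ler_norm _) _; rewrite -normrN -sub0r.
  by near: m; exact: cvgE.
pose m n := sval (E_small n).
pose N := \bigcup_n E n (m n).
have mN : measurable N by apply: bigcupT_measurable.
have muN : (mu N <= e%:E)%E.
  apply: le_trans (measure_sigma_subadditive mu _ mN (@subset_refl _ N)) _.
    by move=> n; exact: mE.
  apply: (@le_trans _ _ (\sum_(n <oo) (e / (2 ^ n.+1)%:R)%:E)%E).
    by apply: lee_nneseries => // n _; rewrite ltW//; exact: svalP (E_small n).
  by apply: epsilon_trick0; exact: ltW.
exists (B `\` N); split.
- exact: measurableD.
- by move=> x [].
- rewrite ltNge; apply/negP => BN0.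
  have : (mu B <= mu (B `\` N) + mu N)%E.
    rewrite (measureDI mu mB mN).
    by apply: leeD2l; apply: le_measure; rewrite ?inE//; exact: measurableI.
  move=> /le_trans /(_ (leeD BN0 muN)); rewrite add0e -(fineK fB) lee_fin.
  by move: e0; rewrite /e; lra.
- move=> n; exists (m n)%:R => x [Bx Nx]; rewrite leNgt; apply/negP => xm.
  by apply: Nx; exists n.
Unshelve. all: by end_near. Qed.

End measure_lemmas.

Section euclidean_balls.
Context {R : realType} {d : nat}.
Implicit Types (x : 'rV[R]_d) (U : set 'rV[R]_d).

Lemma euclidean_ball_nbhs x y (r : R) :
  euclidean_ball x r y -> nbhs y (euclidean_ball x r).
Proof.
move=> xry.
have : (Num.sqrt (\sum_(i < d) (z 0 i - x 0 i) ^+ 2)) @[z --> y] -->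
    Num.sqrt (\sum_(i < d) (y 0 i - x 0 i) ^+ 2).
  apply: continuous_cvg; first exact: sqrt_continuous.
  apply: cvg_big => [|i _]; first exact: add_continuous.
  have zi : z 0 i - x 0 i @[z --> y] --> y 0 i - x 0 i.
    by apply: cvgB; [exact: coord_continuous|exact: cvg_cst].
  by rewrite expr2; under eq_cvg do rewrite expr2; exact: cvgM.
by move=> /cvgr_lt /(_ _ xry).
Qed.

Lemma nbhs_euclidean_ball x U :
  nbhs x U -> exists2 r : R, 0 < r & euclidean_ball x r `<=` U.
Proof.
move=> /nbhs_ballP[r /= r0 xrU]; exists r => // y xy; apply: xrU.
split=> // i j; rewrite (ord1 i) /ball/=; apply: le_lt_trans xy.
rewrite distrC -sqrtr_sqr ler_wsqrtr// (bigD1 j)//= lerDl.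
by apply: sumr_ge0 => k _; exact: sqr_ge0.
Qed.

End euclidean_balls.

Lemma modulus_gt0 (R : realType) (z : R[i]) : (0 < modulus z) = (z != 0).
Proof.
rewrite lt_def andbC; case: z => a b; rewrite sqrtr_ge0 /=.
apply/idP/idP; apply: contraNN => /eqP.
  by case=> -> ->; rewrite !expr0n addr0 sqrtr0.
by move/(@ComplexField.Normc.eq0_normc _ (a +i* b)%C) => ->.
Qed.

Lemma modulusZ (R : realType) (l : R) (z : R[i]) :
  0 <= l -> modulus (l%:C%C * z) = l * modulus z.
Proof.
by move=> l0; rewrite ComplexField.Normc.normcM /= expr0n addr0 sqrtr_sqr ger0_norm.
Qed.

Section musielak_orlicz_functions.
Context {R : realType} {d : nat}.
Variables (Omega : set 'rV[R]_d) (Phi : 'rV[R]_d -> R -> R).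
Hypothesis mo : musielak_orlicz_function Omega Phi.

Lemma mo_scale x (p t : R) : Omega x -> 0 <= p <= 1 -> 0 <= t ->
  Phi x (p * t) <= p * Phi x t.
Proof.
move=> Ox /andP[p0 p1] t0.
have : Phi x (p * t + (1 - p) * 0) <= p * Phi x t + (1 - p) * Phi x 0.
  have tD : t \in `[0, +oo[%classic by apply: mem_set; rewrite /= in_itv/= t0.
  have zD : (0 : R) \in `[0, +oo[%classic by apply: mem_set; rewrite /= in_itv/= lexx.
  exact: (mo_convex mo Ox (Itv01 p0 p1) tD zD).
rewrite mulr0 addr0.
by rewrite (mo_eq0 mo Ox (lexx 0)).2// mulr0 addr0.
Qed.

Lemma mo_le x (s t : R) : Omega x -> 0 <= s <= t -> Phi x s <= Phi x t.
Proof.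
move=> Ox /andP[s0]; rewrite le_eqVlt => /predU1P[->//|st].
have t0 := le_lt_trans s0 st.
have p01 : 0 <= s / t <= 1 by rewrite divr_ge0 ?(ltW t0)//= ler_pdivrMr// mul1r ltW.
have := mo_scale Ox p01 (ltW t0); rewrite divfK ?gt_eqF// => /le_trans; apply.
by rewrite ler_piMl ?(andP p01).2// (mo_ge0 mo Ox (ltW t0)).
Qed.

Lemma modular_ge_restrict (A : set 'rV[R]_d) (g : 'rV[R]_d -> R[i])
    (h : 'rV[R]_d -> R) :
  A `<=` Omega -> (forall x, A x -> 0 <= h x <= Phi x (modulus (g x))) ->
  (\int[@lebesgue_rV R d]_(x in A) (h x)%:E <= modular Omega Phi g)%E.
Proof.
move=> AO hPhi.
have modular0 x : Omega x -> (0 <= (Phi x (modulus (g x)))%:E)%E.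
  by move=> Ox; rewrite lee_fin (mo_ge0 mo)//; case: (g x) => *; exact: sqrtr_ge0.
apply: ge0_le_integral_supp => // [x /hPhi/andP[]//|x|x /AO//].
by move=> /hPhi/andP[_]; rewrite lee_fin.
Qed.

Lemma singular_points_nbhs x (U : set 'rV[R]_d) :
  singular_points Omega Phi x -> nbhs x U -> exists2 t : R, 0 < t &
    (\int[@lebesgue_rV R d]_(y in U `&` Omega) (Phi y t)%:E = +oo)%E.
Proof.
move=> Sx /nbhs_euclidean_ball[r r0 rU]; have [t t0 Ioo] := Sx r r0.
exists t => //; apply/eqP; rewrite -leye_eq -Ioo.
have Phi0 y : Omega y -> (0 <= (Phi y t)%:E)%E.
  by move=> Oy; rewrite lee_fin (mo_ge0 mo)// ltW.
apply: ge0_le_integral_supp => [y [_ /Phi0//]|y [_ /Phi0//]|//|y].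
by move=> [/rU Uy Oy] /not_andP[].
Qed.

Lemma closed_singular_points : closed (singular_points Omega Phi).
Proof.
move=> x clx r r0.
have xr : nbhs x (euclidean_ball x r).
  apply: euclidean_ball_nbhs; rewrite /euclidean_ball/= big1 ?sqrtr0// => i _.
  by rewrite subrr expr0n.
by have [y [Sy /euclidean_ball_nbhs/singular_points_nbhs]] := clx _ xr; apply.
Qed.

Lemma Cc_infty_EPhi_singular_eq0 (g : 'rV[R]_d -> R[i]) x :
  Cc_infty Omega g -> EPhi Omega Phi g ->
  singular_points Omega Phi x -> Omega x -> g x = 0.
Proof.
move=> [smoothRe smoothIm _ _] [_ Eg] Sx Ox.
apply: contrapT => /eqP; rewrite -modulus_gt0 => gx0.
have modulusE y : modulus (g y) =
    Num.sqrt (complex.Re (g y) ^+ 2 + complex.Im (g y) ^+ 2).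
  by case: (g y).
have cont_modulus : modulus (g y) @[y --> x] --> modulus (g x).
  have cRe : complex.Re (g y) @[y --> x] --> complex.Re (g x).
    exact: differentiable_continuous (smoothRe [::] x Ox).
  have cIm : complex.Im (g y) @[y --> x] --> complex.Im (g x).
    exact: differentiable_continuous (smoothIm [::] x Ox).
  rewrite (_ : (fun y => modulus (g y)) = Num.sqrt \o
      (fun y => complex.Re (g y) * complex.Re (g y) +
                complex.Im (g y) * complex.Im (g y))); last first.
    by apply/funext => y /=; rewrite modulusE !expr2.
  rewrite modulusE !expr2; apply: continuous_cvg.
  - exact: nbhs_filter.
  - exact: sqrt_continuous.
  - exact: (cvgD (cvgM cRe cRe) (cvgM cIm cIm)).
pose c := modulus (g x) / 2.
have c0 : 0 < c by rewrite divr_gt0.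
have c_lt : c < modulus (g x) by rewrite /c; lra.
have U_nbhs : nbhs x [set y | c < modulus (g y)].
  by move/cvgr_gt : cont_modulus => /(_ _ c_lt).
have [t t0 Ioo] := singular_points_nbhs Sx U_nbhs.
have := Eg (t / c); rewrite divr_gt0// => /(_ isT); rewrite ltNge.
move=> /negP; apply; rewrite -Ioo; apply: modular_ge_restrict => [y []//|y [cy Oy]].
rewrite (mo_ge0 mo Oy (ltW t0)) modulusZ; last by rewrite ltW// divr_gt0.
apply: mo_le => //; rewrite (ltW t0) /= mulrAC ler_pdivlMr//.
by rewrite ler_pM2l// ltW.
Qed.

Lemma indic_EPhi (A : set 'rV[R]_d) :
  measurable (A : set (lebesgue_space R d)) -> A `<=` Omega ->
  (@lebesgue_rV R d A < +oo)%E ->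
  (forall n : nat, exists M : R, forall x, A x -> Phi x n%:R <= M) ->
  EPhi Omega Phi (fun x => (\1_A x)%:C%C).
Proof.
move=> mA AO Aoo boundPhi; split.
  by split=> /=; [exact: measurable_realfun.measurable_indic|exact: measurable_cst].
move=> l l0; have [M PhiM] := boundPhi (Num.truncn l).+1.
have PhilM x : A x -> Phi x l <= `|M|.
  move=> Ax; apply: le_trans (ler_norm M); apply: le_trans (PhiM x Ax).
  by apply: mo_le; [exact: AO|rewrite (ltW l0)/= ltW// truncnS_gt].
apply: (@le_lt_trans _ _ (\int[@lebesgue_rV R d]_(x in A) (`|M|)%:E)%E); last first.
  by rewrite integral_cst// lte_mul_pinfty.
apply: ge0_le_integral_supp => // x Ox.
- rewrite lee_fin (mo_ge0 mo)// modulusZ ?(ltW l0)// mulr_ge0 ?(ltW l0)//.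
  exact: sqrtr_ge0.
- move=> Ax; rewrite modulusZ ?(ltW l0)//= expr0n addr0 sqrtr_sqr indicE.
  by rewrite mem_set// normr1 mulr1 lee_fin PhilM.
- move=> xA; rewrite modulusZ ?(ltW l0)//= expr0n addr0 sqrtr_sqr indicE.
  by rewrite memNset// normr0 mulr0 (mo_eq0 mo Ox (lexx 0)).2.
Qed.

End musielak_orlicz_functions.

Theorem theorem6 (R : realType) (d : nat) (Omega : set 'rV[R]_d)
    (Phi : 'rV[R]_d -> R -> R) :
  open Omega -> musielak_orlicz_function Omega Phi ->
  (0 < @lebesgue_rV R d (singular_points Omega Phi `&` Omega))%E ->
  ~ norm_dense (luxemburg_norm Omega Phi)
      (Cc_infty Omega `&` EPhi Omega Phi) (EPhi Omega Phi).
Proof.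
move=> oO mo muS [_ dense].
have mO := open_lebesgue_measurable oO.
pose S : set (lebesgue_space R d) := singular_points Omega Phi `&` Omega.
have mS : measurable S.
  apply: measurableI => //; rewrite -[X in measurable X]setCK; apply: measurableC.
  by apply: open_lebesgue_measurable; apply: closed_openC;
    exact: closed_singular_points.
pose B n : set (lebesgue_space R d) := S `&`
  cell (Some (const_mx (- n%:R), const_mx n%:R)) `&`
  (Omega `&` [set x | n.+1%:R^-1 <= Phi x 1]).
have mB n : measurable (B n).
  apply: measurableI; first by apply: measurableI => //; exact: cell_measurable.
  apply: measurable_fun_le => //; exact: (mo_measurable mo ler01).
have [n muB] : exists n, (0 < @lebesgue_rV R d (B n))%E.
  apply: (measure_bigcup_gt0 mS mB _ muS) => x [Sx Ox].
  have Phi1 : 0 < Phi x 1.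
    rewrite lt_neqAle (mo_ge0 mo)// andbT eq_sym; apply/eqP.
    by move=> /(mo_eq0 mo Ox ler01).1/eqP; rewrite oner_eq0.
  pose m := Num.truncn (\sum_i `|x 0 i| + (Phi x 1)^-1).
  have xm : \sum_i `|x 0 i| + (Phi x 1)^-1 < m.+1%:R by exact: truncnS_gt.
  have sum0 : 0 <= \sum_i `|x 0 i| by exact: sumr_ge0.
  have Phi1V : 0 < (Phi x 1)^-1 by rewrite invr_gt0.
  exists m.+1 => //; split; split=> //=.
    move=> i; rewrite !mxE; suff : `|x 0 i| < m.+1%:R.
      by rewrite ltr_norml => /andP[-> /ltW].
    apply: le_lt_trans xm; rewrite (bigD1 i)//= -addrA lerDl.
    by rewrite addr_ge0 ?(ltW Phi1V)// sumr_ge0.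
  rewrite -[leRHS]invrK lef_pV2 ?posrE// -natr1.
  by move: xm; lra.
have Boo : (@lebesgue_rV R d (B n) < +oo)%E.
  apply: le_lt_trans (cell_lt_pinfty (Some (const_mx (- n%:R), const_mx n%:R))).
  by apply: le_outer_measure => x [[]].
have BO : B n `<=` Omega by move=> x [_ []].
have [|k|A [mA AB muA boundA]] :=
    @bounded_on_large_subset _ _ _ (@lebesgue_rV R d) (B n)
      (fun k x => Phi x k%:R) (mB n).
- by rewrite muB.
- exact: measurable_funS mO BO (mo_measurable mo (ler0n _ k)).
have AO := subset_trans AB BO.
have Aoo : (@lebesgue_rV R d A < +oo)%E.
  by apply: le_lt_trans Boo; exact: le_outer_measure.
have fA : @lebesgue_rV R d A \is a fin_num by rewrite ge0_fin_numE.
pose a := fine (@lebesgue_rV R d A).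
have a0 : 0 < a by rewrite fine_gt0// muA.
pose e := Num.min 1 (a / n.+1%:R).
have e0 : 0 < e by rewrite lt_min ltr01 divr_gt0.
have [g [Cg Eg] /ereal_inf_lt[_ [l [l0 Il] <-]]] :=
  dense _ (indic_EPhi mo mA AO Aoo boundA) _ e0.
rewrite lte_fin lt_min => /andP[l1 la].
have : (\int[@lebesgue_rV R d]_(x in A) (l^-1 * n.+1%:R^-1)%:E <= 1)%E.
  apply: le_trans Il; apply: modular_ge_restrict => // x Ax.
  have [[[Sx Ox] _] [_ /= Phi1]] := AB _ Ax.
  rewrite (Cc_infty_EPhi_singular_eq0 mo Cg Eg Sx Ox) subr0 indicE mem_set//.
  have -> : modulus (1%:C%C / l%:C%C) = l^-1.
    rewrite ComplexField.Normc.normcM ComplexField.Normc.normcV.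
    by rewrite ComplexField.Normc.normc1 mul1r /= expr0n addr0 sqrtr_sqr gtr0_norm.
  rewrite mulr_ge0 ?invr_ge0 ?(ltW l0)//=.
  have l01 : 0 <= l <= 1 by rewrite !ltW.
  have lV0 : 0 <= l^-1 by rewrite invr_ge0 ltW.
  have := mo_scale mo Ox l01 lV0; rewrite divff ?gt_eqF// => Phi1l.
  by rewrite mulrC ler_pdivrMr// mulrC; exact: le_trans Phi1 Phi1l.
rewrite integral_cst//.
rewrite (_ : (_ * _)%E = (l^-1 * n.+1%:R^-1 * a)%:E); last first.
  by rewrite [RHS]EFinM /a fineK.
rewrite lee_fin.
rewrite mulrAC -mulrA mulrC ler_pdivrMr// mul1r => /le_lt_trans/(_ la).
by rewrite ltxx.
Qed.
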